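(* Let $L\in\mathbb{N}$ ($L\ge1$) and let $S\ge2$ be an integer. Then the $LS$-sequence of points with parameters $L$ and $S$ does not coincide with an orbit $(f^n(x))_{n\ge0}$ of any interval exchange transformation $f$ (with finitely many intervals).
   Context: $LS$-sequences: let $\beta$ be the positive solution of $L\beta+S\beta^2=1$. Let $\rho_{L,S}$ be the partition of $[0,1)$ into $L+S$ consecutive half-open intervals, the first $L$ of length $\beta$ and the following $S$ of length $\beta^2$. Given a partition $\pi$ of $[0,1)$, its $\rho_{L,S}$-refinement $\rho_{L,S}\pi$ is obtained by subdividing all intervals of maximal length of $\pi$ positively homothetically to $\rho_{L,S}$. Starting with the trivial partition $\pi=\{[0,1)\}$ one obtains the $LS$-sequence of partitions $(\rho_{L,S}^n\pi)_{n\in\mathbb{N}}$. The partition $\rho_{L,S}^n\pi$ consists of intervals of lengths $\beta^n$ and $\beta^{n+1}$ only; let $t_n$ be its number of intervals, $l_n$ the number of intervals of length $\beta^n$, and $s_n$ the number of intervals of length $\beta^{n+1}$. The $LS$-sequence of points is defined as follows: $\Lambda^1_{L,S}$ is the list of the $t_1$ left endpoints of $\rho_{L,S}\pi$ ordered by magnitude. Given the ordered list $\Lambda^n_{L,S}=(\xi^{(n)}_1,\ldots,\xi^{(n)}_{t_n})$, the ordered list $\Lambda_{L,S}^{n+1}$ is $$\bigl(\xi^{(n)}_1,\ldots,\xi^{(n)}_{t_n},\ \psi^{(n+1)}_{1,0}(\xi^{(n)}_1),\ldots,\psi^{(n+1)}_{1,0}(\xi^{(n)}_{l_n}),\ldots,\psi^{(n+1)}_{L,0}(\xi^{(n)}_1),\ldots,\psi^{(n+1)}_{L,0}(\xi^{(n)}_{l_n}),$$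 $$\psi^{(n+1)}_{L,1}(\xi^{(n)}_1),\ldots,\psi^{(n+1)}_{L,1}(\xi^{(n)}_{l_n}),\ldots,\psi^{(n+1)}_{L,S-1}(\xi^{(n)}_1),\ldots,\psi^{(n+1)}_{L,S-1}(\xi^{(n)}_{l_n})\bigr),$$ where $\psi^{(n)}_{i,j}(x)=x+i\beta^n+j\beta^{n+1}$. Since $\Lambda^n_{L,S}$ is an initial segment of $\Lambda^{n+1}_{L,S}$ for each $n$, these lists define one infinite sequence in $[0,1)$, the $LS$-sequence of points. Interval exchange transformation: let $\mathcal{A}$ be a finite alphabet with $n$ elements, $\pi_0,\pi_1:\mathcal{A}\to\{1,\ldots,n\}$ bijections (combinatorial data), $\lambda_\alpha>0$ for $\alpha\in\mathcal{A}$ (length data) and $\lambda^*=\sum_\alpha\lambda_\alpha$. Partition $[0,\lambda^* )$ into the intervals $I_\alpha=\bigl[\sum_{\pi_0(\gamma)<\pi_0(\alpha)}\lambda_\gamma,\ \lambda_\alpha+\sum_{\pi_0(\gamma)<\pi_0(\alpha)}\lambda_\gamma\bigr)$. The corresponding interval exchange transformation $f:[0,\lambda^* )\to[0,\lambda^* )$ is $f(x)=x+w_\alpha$ for $x\in I_\alpha$, where $w_\alpha=\sum_{\pi_1(\gamma)<\pi_1(\alpha)}\lambda_\gamma-\sum_{\pi_0(\gamma)<\pi_0(\alpha)}\lambda_\gamma$. *)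

(* Defs.v *)
From mathcomp Require Import all_boot all_order all_algebra.
From mathcomp Require Import reals.
Set Implicit Arguments.
Unset Strict Implicit.
Unset Printing Implicit Defensive.
Import Order.TTheory GRing.Theory Num.Theory.
Local Open Scope ring_scope.

(* A half-open interval [a, b) is the pair (a, b), and a finite partition of
   [0, 1) is the list of its intervals. *)
Definition ilen (R : realType) (J : R * R) : R := J.2 - J.1.

Definition max_ilen (R : realType) (P : seq (R * R)) : R :=
  \big[Num.max/0]_(J <- P) ilen J.

Definition subdivide (R : realType) (rho : seq (R * R)) (J : R * R) :
    seq (R * R) :=
  [seq (J.1 + ilen J * K.1, J.1 + ilen J * K.2) | K <- rho].

Definition refine (R : realType) (rho P : seq (R * R)) : seq (R * R) :=
  flatten [seq if ilen J == max_ilen P then subdivide rho J else [:: J]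
          | J <- P].

Definition rhoLS (R : realType) (L S : nat) (beta : R) : seq (R * R) :=
  [seq (i%:R * beta, i.+1%:R * beta) | i <- iota 0 L] ++
  [seq (L%:R * beta + j%:R * beta ^+ 2, L%:R * beta + j.+1%:R * beta ^+ 2)
  | j <- iota 0 S].

Definition LS_partition (R : realType) (L S : nat) (beta : R) (n : nat) :
    seq (R * R) :=
  iter n (refine (rhoLS L S beta)) [:: (0, 1)].

Definition LS_long (R : realType) (L S : nat) (beta : R) (n : nat) : nat :=
  count (fun J => ilen J == beta ^+ n) (LS_partition L S beta n).

Definition psi (R : realType) (beta : R) (n i j : nat) (x : R) : R :=
  x + i%:R * beta ^+ n + j%:R * beta ^+ n.+1.

(* [LS_list L S beta m] is the (m+1)-st list of points, Lambda^(m+1). *)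
Fixpoint LS_list (R : realType) (L S : nat) (beta : R) (m : nat) : seq R :=
  match m with
  | 0 => sort <=%R [seq J.1 | J <- LS_partition L S beta 1]
  | m'.+1 =>
      let xi := LS_list L S beta m' in
      let xi_long := take (LS_long L S beta m) xi in
      xi ++ [seq psi beta m.+1 i 0 x | i <- iota 1 L, x <- xi_long]
         ++ [seq psi beta m.+1 L j x | j <- iota 1 S.-1, x <- xi_long]
  end.

Lemma prefix_LS_list (R : realType) (L S : nat) (beta : R) (m : nat) :
  prefix (LS_list L S beta m) (LS_list L S beta m.+1).
Proof. exact: prefix_prefix. Qed.

(* The k-th point, counted from 0.  When 1 <= L and 2 <= S, Lambda^(k+1) has
   more than k elements, so that the default value of nth is not used. *)
Definition LS_point (R : realType) (L S : nat) (beta : R) (k : nat) : R :=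
  nth 0 (LS_list L S beta k) k.

(* Combinatorial data pi_0 = iet_top and pi_1 = iet_bot, with positions numbered
   from 0 instead of 1, and length data. *)
Record iet (R : realType) (A : finType) := IET {
  iet_top : A -> 'I_#|A|;
  iet_bot : A -> 'I_#|A|;
  iet_len : A -> R;
  iet_top_bij : bijective iet_top;
  iet_bot_bij : bijective iet_bot;
  iet_len_gt0 : forall a, 0 < iet_len a
}.

Definition iet_total (R : realType) (A : finType) (T : iet R A) : R :=
  \sum_(a : A) iet_len T a.

Definition iet_left_top (R : realType) (A : finType) (T : iet R A) (a : A) : R :=
  \sum_(c : A | (iet_top T c < iet_top T a)%N) iet_len T c.

Definition iet_left_bot (R : realType) (A : finType) (T : iet R A) (a : A) : R :=
  \sum_(c : A | (iet_bot T c < iet_bot T a)%N) iet_len T c.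

Definition iet_shift (R : realType) (A : finType) (T : iet R A) (a : A) : R :=
  iet_left_bot T a - iet_left_top T a.

(* The intervals I_a partition [0, iet_total T), so at most one a can be picked;
   outside [0, iet_total T) the map is extended by the identity. *)
Definition iet_map (R : realType) (A : finType) (T : iet R A) (x : R) : R :=
  if [pick a | iet_left_top T a <= x < iet_len T a + iet_left_top T a] is Some a
  then x + iet_shift T a else x.

(* Main.v *)
Require Import Defs.
From mathcomp Require Import all_boot all_order all_algebra.
From mathcomp Require Import reals.
From mathcomp Require Import zify lra.
Import Order.TTheory GRing.Theory Num.Theory.
Local Open Scope ring_scope.

(** Two consecutive points of an orbit of an interval exchange transformation
    differ by one of its finitely many translation lengths (or by 0, where
    [iet_map] is the identity).  It is therefore enough to exhibit infinitely
    many values among the differences of consecutive points of the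
    LS-sequence.

    Write l_n for the number of long intervals of the n-th partition and e_n
    for the l_n-th point of the sequence, the last one that is translated in
    the step from Lambda^n to Lambda^(n+1).  As S >= 2, that step appends the
    translates of xi_1, ..., xi_(l_n) by L beta^(n+1) and directly afterwards
    their translates by L beta^(n+1) + beta^(n+2).  At the seam between these
    two blocks the sequence jumps by xi_1 + beta^(n+2) - e_n
    ([LS_point_jump]).

    The numbers e_n increase over every two steps ([last_longSS]).  Indeed
    l_(n+1) = t_n + (L - 1) l_n.  For L >= 2 this makes e_(n+1) the last
    element of the block of translates by (L - 1) beta^(n+1), so it is larger
    than e_n.  For L = 1 it makes e_(n+2) the last element of Lambda^(n+1),
    which is again a positive translate of e_n.  Since beta < 1, the
    jumps at the steps n, n+2, n+4, ... strictly decrease, hence are pairwise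
    distinct.

    The counts l_n behind these positions come from the recursion for the
    interval lengths of the partitions ([perm_ilen_LS_partition]). *)

(** * Interval lengths of the partitions *)

(** The pair (l_n, s_n): refining turns each long interval into L long and S
    short ones of the next generation, while the short intervals become the
    remaining long ones. *)
Fixpoint LS_counts (L S n : nat) : nat * nat :=
  if n is n'.+1 then
    let: (l, s) := LS_counts L S n' in (L * l + s, S * l)%N
  else (1, 0)%N.

Lemma LS_countsS (L S n : nat) :
  LS_counts L S n.+1 =
  (L * (LS_counts L S n).1 + (LS_counts L S n).2, S * (LS_counts L S n).1)%N.
Proof. by rewrite /=; case: LS_counts. Qed.

Lemma LS_counts_gt0 (L S n : nat) : (1 <= L)%N -> (0 < (LS_counts L S n).1)%N.
Proof.
move=> L_gt0; elim: n => // n IHn.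
by rewrite LS_countsS addn_gt0 muln_gt0 L_gt0 IHn.
Qed.

(** The lists of points grow by concatenated blocks of equal size, so a
    position inside them is addressed by a block and an offset. *)
Lemma nth_allpairs (U V W : Type) (f : U -> V -> W) (u0 : U) (v0 : V) (w0 : W)
    (us : seq U) (vs : seq V) (i k : nat) :
  (i < size us)%N -> (k < size vs)%N ->
  nth w0 [seq f u v | u <- us, v <- vs] (i * size vs + k) =
  f (nth u0 us i) (nth v0 vs k).
Proof.
elim: us i => //= u us IHus [|i] lt_i lt_k; rewrite nth_cat size_map.
  by rewrite lt_k (nth_map v0).
rewrite mulSn -addnA ltnNge leq_addr /= addKn; exact: IHus.
Qed.

Section LSSequence.
Variables (R : realType) (L S : nat) (beta : R).
Hypotheses (L_gt0 : (1 <= L)%N) (beta_gt0 : 0 < beta) (beta_lt1 : beta < 1).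

Lemma ilen_rhoLS :
  [seq ilen K | K <- rhoLS L S beta] = nseq L beta ++ nseq S (beta ^+ 2).
Proof.
rewrite map_cat -!map_comp -[in nseq L _](size_iota 0 L) -[in nseq S _](size_iota 0 S).
congr (_ ++ _); elim: iota => //= i r ->; rewrite /ilen /= -addn1 natrD;
  by congr (_ :: _); lra.
Qed.

Lemma ilen_subdivide (rho : seq (R * R)) (J : R * R) :
  [seq ilen K | K <- subdivide rho J] = [seq ilen J * a | a <- map (@ilen R) rho].
Proof.
rewrite -!map_comp; apply: eq_map => K /=.
by rewrite /ilen /= opprD addrACA subrr add0r -mulrBr.
Qed.

(** The effect of a refinement on lengths alone: left endpoints do not
    influence which intervals are subdivided, so the lengths form a
    self-contained recursion. *)
Definition refine_len (M a : R) : seq R :=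
  if a == M then nseq L (a * beta) ++ nseq S (a * beta ^+ 2) else [:: a].

Lemma ilen_refine (P : seq (R * R)) :
  [seq ilen J | J <- refine (rhoLS L S beta) P] =
  flatten [seq refine_len (max_ilen P) a | a <- map (@ilen R) P].
Proof.
rewrite /refine map_flatten -!map_comp; congr flatten; apply: eq_map => J /=.
rewrite /refine_len; case: eqP => //= _.
by rewrite ilen_subdivide ilen_rhoLS map_cat !map_nseq.
Qed.

Lemma max_ilen_two_lengths (P : seq (R * R)) (a b : R) (l s : nat) :
  (0 < l)%N -> 0 <= b <= a ->
  perm_eq [seq ilen J | J <- P] (nseq l a ++ nseq s b) -> max_ilen P = a.
Proof.
move=> l_gt0 /andP[b_ge0 le_ba] permP.
rewrite /max_ilen -(big_map (@ilen R) xpredT id) /= (perm_big _ permP) /=.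
apply/eqP; rewrite eq_le; apply/andP; split.
  rewrite big_seq; apply: bigmax_le => [|c]; first exact: le_trans le_ba.
  by rewrite mem_cat => /orP[] /nseqP[->].
by apply: le_bigmax_seq => //; rewrite mem_cat mem_nseq l_gt0 eqxx.
Qed.

(** The order of the intervals is irrelevant for counting them, and up to order
    the lengths are l_n copies of beta^n and s_n copies of beta^(n+1).  Since
    l_n > 0 and beta < 1, the maximal length is beta^n, so exactly the l_n
    long intervals get subdivided. *)
Lemma perm_ilen_LS_partition (n : nat) :
  perm_eq [seq ilen J | J <- LS_partition L S beta n]
    (nseq (LS_counts L S n).1 (beta ^+ n) ++
     nseq (LS_counts L S n).2 (beta ^+ n.+1)).
Proof.
elim: n => [|n IHn]; first by rewrite /= /ilen subr0.
rewrite [LS_partition _ _ _ _]/(refine _ (LS_partition L S beta n)) ilen_refine.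
have ltXb: beta ^+ n.+1 < beta ^+ n by rewrite exprS gtr_pMl ?exprn_gt0.
rewrite (max_ilen_two_lengths _ (beta ^+ n) _ _ _ _ _ IHn); last first.
- by rewrite exprn_ge0 ?ltW.
- exact: LS_counts_gt0.
apply: perm_trans (perm_flatten (perm_map _ IHn)) _.
rewrite map_cat flatten_cat !map_nseq /refine_len eqxx (lt_eqF ltXb).
apply/permP => p; rewrite LS_countsS !count_cat !count_flatten !map_nseq !sumn_nseq.
rewrite !count_cat !count_nseq /= -!exprSr -exprD addn2; lia.
Qed.

Lemma LS_longE (n : nat) : LS_long L S beta n = (LS_counts L S n).1.
Proof.
have ltXb: beta ^+ n.+1 < beta ^+ n by rewrite exprS gtr_pMl ?exprn_gt0.
rewrite /LS_long -(count_map _ (pred1 (beta ^+ n))).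
move/permP: (perm_ilen_LS_partition n) => ->.
by rewrite count_cat !count_nseq /= eqxx (lt_eqF ltXb) mul1n addn0.
Qed.

Lemma size_LS_list (m : nat) : (1 <= S)%N ->
  size (LS_list L S beta m) = ((LS_counts L S m.+1).1 + (LS_counts L S m.+1).2)%N.
Proof.
move=> S_gt0; elim: m => [|m IHm].
  rewrite [LS_list _ _ _ _]/= size_sort size_map -(size_map (@ilen R)).
  by rewrite (perm_size (perm_ilen_LS_partition 1)) size_cat !size_nseq.
rewrite [LS_list _ _ _ _]/= !size_cat !size_allpairs !size_iota LS_longE.
rewrite size_takel IHm ?leq_addr // [in RHS]LS_countsS.
case: (S) S_gt0 => //= S' _; lia.
Qed.

(** * Positions in the lists of points *)

Hypothesis S_gt1 : (2 <= S)%N.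
Let S_gt0 : (1 <= S)%N := ltnW S_gt1.

(* The lists are numbered from 0: [Lambda m] is Lambda^(m+1), and
   [ell m] is l_(m+1), the number of its points that the next step translates. *)
Let Lambda (m : nat) : seq R := LS_list L S beta m.
Let ell (m : nat) : nat := (LS_counts L S m.+1).1.

Lemma size_take_long (m : nat) : size (take (ell m) (Lambda m)) = ell m.
Proof. by rewrite size_takel // size_LS_list // leq_addr. Qed.

Lemma nth_LS_list_prefix (m n k : nat) :
  (m <= n)%N -> (k < size (Lambda m))%N -> nth 0 (Lambda n) k = nth 0 (Lambda m) k.
Proof.
move=> /subnKC <- lt_k.
suff [r ->] : exists r, Lambda (m + (n - m)) = Lambda m ++ r by rewrite nth_cat lt_k.
elim: (n - m)%N => [|d [r IHd]]; first by exists [::]; rewrite addn0 cats0.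
rewrite addnS /Lambda; have /prefixP[r' ->] := prefix_LS_list L S beta (m + d).
by exists (r ++ r'); rewrite catA -/(Lambda (m + d)) IHd.
Qed.

Lemma size_LS_listS (m : nat) :
  size (Lambda m.+1) = (size (Lambda m) + (L + S).-1 * ell m)%N.
Proof.
rewrite !size_LS_list // (LS_countsS _ _ m.+1) /ell /=; case: (S) S_gt0 => //= S' _.
by nia.
Qed.

Lemma ltn_size_LS_list (m : nat) : (m < size (Lambda m))%N.
Proof.
elim: m => [|m IHm]; rewrite ?size_LS_listS.
  by rewrite size_LS_list // ltn_addr // LS_counts_gt0.
by have := LS_counts_gt0 L S m.+1 L_gt0; rewrite -/(ell m); nia.
Qed.

(** The lists are prefixes of one another, so the list that [LS_point] selects
    may be exchanged for the one whose block structure is needed. *)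
Lemma LS_pointE (m k : nat) :
  (k < size (Lambda m))%N -> LS_point L S beta k = nth 0 (Lambda m) k.
Proof.
move=> lt_k; rewrite /LS_point; have [le_mk|/ltnW le_km] := leqP m k.
  exact: nth_LS_list_prefix.
by rewrite (nth_LS_list_prefix k m) ?ltn_size_LS_list.
Qed.

Lemma nth_long_block (m i k : nat) : (i < L)%N -> (k < ell m)%N ->
  nth 0 (Lambda m.+1) (size (Lambda m) + (i * ell m + k)) =
  nth 0 (Lambda m) k + i.+1%:R * beta ^+ m.+2.
Proof.
move=> lt_i lt_k; rewrite /Lambda [LS_list _ _ _ _.+1]/= LS_longE // -/(ell m).
rewrite nth_cat ltnNge leq_addr /= addKn nth_cat size_allpairs size_iota.
rewrite -[X in (_ < _ * X)%N]/(size (take (ell m) (Lambda m))) size_take_long.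
have -> : (i * ell m + k < L * ell m)%N by nia.
rewrite -[X in (_ * X + _)%N]size_take_long.
rewrite (nth_allpairs _ _ _ _ 0%N 0) ?size_iota ?size_take_long //.
by rewrite nth_iota // nth_take // /psi mul0r addr0 add1n.
Qed.

Lemma nth_short_block (m j k : nat) : (j < S.-1)%N -> (k < ell m)%N ->
  nth 0 (Lambda m.+1) (size (Lambda m) + (L * ell m + (j * ell m + k))) =
  nth 0 (Lambda m) k + L%:R * beta ^+ m.+2 + j.+1%:R * beta ^+ m.+3.
Proof.
move=> lt_j lt_k; rewrite /Lambda [LS_list _ _ _ _.+1]/= LS_longE // -/(ell m).
rewrite nth_cat ltnNge leq_addr /= addKn nth_cat size_allpairs size_iota.
rewrite -[X in (_ < _ * X)%N]/(size (take (ell m) (Lambda m))) size_take_long.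
rewrite ltnNge leq_addr /= addKn -[X in (_ * X + _)%N]size_take_long.
rewrite (nth_allpairs _ _ _ _ 0%N 0) ?size_iota ?size_take_long //.
by rewrite nth_iota // nth_take // /psi add1n.
Qed.

(** * The jumps between consecutive blocks *)

(** The last point that is translated when [Lambda m] is extended. *)
Definition last_long (m : nat) : R := nth 0 (Lambda m) (ell m).-1.

(** The jump sits at the seam between the translates by L beta^(m+2) and those
    by L beta^(m+2) + beta^(m+3); the latter block exists because S >= 2. *)
Lemma LS_point_jump (m : nat) : exists k,
  LS_point L S beta k.+1 - LS_point L S beta k =
  LS_point L S beta 0 + beta ^+ m.+3 - last_long m.
Proof.
have ell_gt0 : (0 < ell m)%N by exact: LS_counts_gt0.
have lt_size j : (j < (L + S).-1 * ell m)%N ->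
  (size (Lambda m) + j < size (Lambda m.+1))%N by rewrite size_LS_listS ltn_add2l.
exists (size (Lambda m) + (L.-1 * ell m + (ell m).-1))%N.
have -> : (size (Lambda m) + (L.-1 * ell m + (ell m).-1)).+1%N =
  (size (Lambda m) + (L * ell m + (0 * ell m + 0)))%N by nia.
rewrite (LS_pointE m.+1) ?(LS_pointE m.+1 (_ + (L.-1 * _ + _))); first last.
- by apply: lt_size; nia.
- by apply: lt_size; nia.
rewrite nth_short_block ?nth_long_block // ?prednK //; [|by lia..].
rewrite -(LS_pointE m) ?(leq_ltn_trans _ (ltn_size_LS_list m)) // /last_long; lra.
Qed.

(** Two steps are needed because for L = 1 a single step gives no comparison:
    then [last_long m.+2] ends the translates of the long points of [Lambda m],
    whereas for L >= 2 already [last_long m.+1] is a translate of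
    [last_long m]. *)
Lemma last_longSS (m : nat) : last_long m < last_long m.+2.
Proof.
have ell_gt0 n : (0 < ell n)%N by exact: LS_counts_gt0.
have ellS n : ell n.+1 = (size (Lambda n) + L.-1 * ell n)%N.
  by rewrite /ell LS_countsS size_LS_list //= -{1}(prednK L_gt0) mulSn addnAC.
have ltn_pell n : ((ell n).-1 < ell n)%N by rewrite prednK.
have Xgt0 n : 0 < beta ^+ n by rewrite exprn_gt0.
have [L_gt1|L_le1] := ltnP 1 L.
  have step n : last_long n < last_long n.+1.
    rewrite [ltRHS]/last_long.
    have -> : (ell n.+1).-1 = (size (Lambda n) + (L.-2 * ell n + (ell n).-1))%N.
      by rewrite ellS; have := ell_gt0 n; nia.
    rewrite nth_long_block ?ltn_pell //; last by lia.
    by rewrite ltrDl mulr_gt0 // ltr0n; lia.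
  exact: lt_trans (step m) (step m.+1).
(* Now the l_(m+3) long points are the whole of [Lambda m.+1], whose last entry
   closes the translates with j = S - 1. *)
have L1 : L = 1%N by lia.
rewrite [ltRHS]/last_long.
have -> : (ell m.+2).-1 =
    (size (Lambda m) + (L * ell m + (S.-2 * ell m + (ell m).-1)))%N.
  by rewrite ellS size_LS_listS L1; have := ell_gt0 m; nia.
rewrite (nth_LS_list_prefix m.+1) // ?size_LS_listS; last by have := ell_gt0 m; nia.
rewrite nth_short_block ?ltn_pell //; last by lia.
by rewrite -addrA ltrDl addr_gt0 // mulr_gt0 // ?ltr0n.
Qed.

End LSSequence.

(** * Comparison with interval exchanges *)

(** The value 0 accounts for the points that lie in none of the exchanged
    intervals. *)
Lemma iet_map_sub_mem (R : realType) (A : finType) (T : iet R A) (y : R) :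
  iet_map T y - y \in 0 :: codom (iet_shift T).
Proof.
rewrite /iet_map inE; case: pickP => [a _|_]; last by rewrite subrr eqxx.
by rewrite addrC addKr codom_f orbT.
Qed.

Theorem theorem3p5 (R : realType) (L S : nat) (beta : R)
    (hL : (1 <= L)%N) (hS : (2 <= S)%N)
    (beta_gt0 : 0 < beta) (beta_root : L%:R * beta + S%:R * beta ^+ 2 = 1)
    (A : finType) (T : iet R A) (x : R) (hx : 0 <= x < iet_total T) :
  ~ (forall n : nat, LS_point L S beta n = iter n (iet_map T) x).
Proof.
move=> orbit.
have beta_lt1 : beta < 1.
  have L1 : 1 <= L%:R :> R by rewrite ler1n.
  have S1 : 1 <= S%:R :> R by rewrite ler1n ltnW.
  by rewrite ltNge; apply/negP => beta_ge1; nra.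
(* Only every second jump is used, to match the two-step monotonicity of
   [last_long]. *)
pose jump k := LS_point L S beta 0 + beta ^+ k.*2.+3 - last_long R L S beta k.*2.
have jump_mem k : jump k \in 0 :: codom (iet_shift T).
  have [n jumpE] := LS_point_jump _ _ _ _ hL beta_gt0 beta_lt1 hS k.*2.
  rewrite /jump -jumpE !orbit iterS; exact: iet_map_sub_mem.
have jump_decr : {homo jump : k n / (k < n)%N >-> n < k}.
  apply: homo_ltn => [u v w uv vw|k]; first exact: lt_trans vw uv.
  rewrite /jump doubleS ler_ltB ?last_longSS // lerD2l.
  by rewrite ler_wiXn2l ?ltW //; lia.
have jump_inj : injective jump.
  move=> k n eq_jump; have [/jump_decr|/jump_decr|//] := ltngtP k n;
    by rewrite eq_jump ltxx.
set vals := 0 :: _ in jump_mem.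
have: (size [seq jump k | k <- iota 0 (size vals).+1] <= size vals)%N.
  apply: uniq_leq_size => [|_ /mapP[k _ ->]]; last exact: jump_mem.
  by rewrite map_inj_uniq ?iota_uniq.
by rewrite size_map size_iota ltnn.
Qed.
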